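(* Let $\mathcal{A}$ and $\mathcal{B}$ be two vector spaces equipped with linear maps $$\phi:\wedge^3\mathcal{A}\to\mathcal{A},\quad\zeta:\wedge^3\mathcal{A}\to\mathcal{B},\quad\psi:\wedge^3\mathcal{B}\to\mathcal{A},\quad\theta:\wedge^3\mathcal{B}\to\mathcal{B},\quad\rho:\wedge^2\mathcal{B}\otimes\mathcal{A}\to\mathcal{A},\quad\sigma:\mathcal{B}\otimes\wedge^2\mathcal{A}\to\mathcal{B}$$ (that is, $\phi,\zeta,\psi,\theta$ are skew-symmetric trilinear, and $\rho,\sigma$ are trilinear and skew-symmetric in their two $\mathcal{B}$-arguments, respectively two $\mathcal{A}$-arguments). Define a skew-symmetric trilinear bracket on $\mathcal{A}\times\mathcal{B}$ by $[(X_1,\eta_1),(X_2,\eta_2),(X_3,\eta_3)]_{{}_{\zeta}\bowtie_{\psi}}=(\widetilde X,\widetilde\eta)$, where $$\widetilde X=\phi(X_1,X_2,X_3)+\psi(\eta_1,\eta_2,\eta_3)+\rho(\eta_2,\eta_3,X_1)-\rho(\eta_1,\eta_3,X_2)+\rho(\eta_1,\eta_2,X_3),$$ $$\widetilde\eta=\theta(\eta_1,\eta_2,\eta_3)+\zeta(X_1,X_2,X_3)+\sigma(\eta_3,X_1,X_2)-\sigma(\eta_2,X_1,X_3)+\sigma(\eta_1,X_2,X_3).$$ Then this bracket defines a $3$-Lie algebra structure on $\mathcal{A}\times\mathcal{B}$ if and only if the following identities hold for all $X_i\in\mathcal{A}$ and $\eta_i\in\mathcal{B}$. (I) \begin{align*}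 &\phi(X_1,X_2,\phi(X_3,X_4,X_5))=\phi(\phi(X_1,X_2,X_3),X_4,X_5)+\phi(X_3,\phi(X_1,X_2,X_4),X_5)+\phi(X_3,X_4,\phi(X_1,X_2,X_5)),\\ &\zeta(X_1,X_2,\phi(X_3,X_4,X_5))+\sigma(\zeta(X_3,X_4,X_5),X_1,X_2)\\ &\quad=\zeta(\phi(X_1,X_2,X_3),X_4,X_5)+\sigma(\zeta(X_1,X_2,X_3),X_4,X_5)\\ &\qquad+\zeta(X_3,\phi(X_1,X_2,X_4),X_5)-\sigma(\zeta(X_1,X_2,X_4),X_3,X_5)\\ &\qquad+\zeta(X_3,X_4,\phi(X_1,X_2,X_5))+\sigma(\zeta(X_1,X_2,X_5),X_3,X_4),\\ &\theta(\eta_1,\eta_2,\theta(\eta_3,\eta_4,\eta_5))=\theta(\theta(\eta_1,\eta_2,\eta_3),\eta_4,\eta_5)+\theta(\eta_3,\theta(\eta_1,\eta_2,\eta_4),\eta_5)+\theta(\eta_3,\eta_4,\theta(\eta_1,\eta_2,\eta_5)),\\ &\psi(\eta_1,\eta_2,\theta(\eta_3,\eta_4,\eta_5))+\rho(\eta_1,\eta_2,\psi(\eta_3,\eta_4,\eta_5))\\ &\quad=\psi(\theta(\eta_1,\eta_2,\eta_3),\eta_4,\eta_5)+\rho(\eta_4,\eta_5,\psi(\eta_1,\eta_2,\eta_3))\\ &\qquad+\psi(\eta_3,\theta(\eta_1,\eta_2,\eta_4),\eta_5)-\rho(\eta_3,\eta_5,\psi(\eta_1,\eta_2,\eta_4))\\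 &\qquad+\psi(\eta_3,\eta_4,\theta(\eta_1,\eta_2,\eta_5))+\rho(\eta_3,\eta_4,\psi(\eta_1,\eta_2,\eta_5)). \end{align*} (II) \begin{align*} &\sigma(\sigma(\eta_5,X_3,X_4),X_1,X_2)=\sigma(\eta_5,\phi(X_1,X_2,X_3),X_4)+\sigma(\eta_5,X_3,\phi(X_1,X_2,X_4))+\sigma(\sigma(\eta_5,X_1,X_2),X_3,X_4),\\ &\rho(\zeta(X_1,X_2,X_3),\eta_5,X_4)-\rho(\zeta(X_1,X_2,X_4),\eta_5,X_3)=0,\\ &\sigma(\eta_2,X_1,\phi(X_3,X_4,X_5))=\sigma(\sigma(\eta_2,X_1,X_3),X_4,X_5)-\sigma(\sigma(\eta_2,X_1,X_4),X_3,X_5)+\sigma(\sigma(\eta_2,X_1,X_5),X_3,X_4),\\ &\rho(\eta_2,\zeta(X_3,X_4,X_5),X_1)=0. \end{align*} (III) \begin{align*} &\phi(X_1,X_2,\rho(\eta_4,\eta_5,X_3))=\psi(\zeta(X_1,X_2,X_3),\eta_4,\eta_5)+\rho(\eta_4,\eta_5,\phi(X_1,X_2,X_3))\\ &\qquad+\rho(\sigma(\eta_4,X_1,X_2),\eta_5,X_3)+\rho(\eta_4,\sigma(\eta_5,X_1,X_2),X_3),\\ &\zeta(X_1,X_2,\rho(\eta_4,\eta_5,X_3))=\theta(\zeta(X_1,X_2,X_3),\eta_4,\eta_5),\\ &\rho(\eta_2,\sigma(\eta_5,X_3,X_4),X_1)=\rho(\sigma(\eta_2,X_1,X_3),\eta_5,X_4)-\rho(\sigma(\eta_2,X_1,X_4),\eta_5,X_3)+\phi(X_3,X_4,\rho(\eta_2,\eta_5,X_1)),\\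 &\zeta(X_3,X_4,\rho(\eta_2,\eta_5,X_1))=0,\\ &\rho(\eta_1,\eta_2,\phi(X_3,X_4,X_5))+\psi(\eta_1,\eta_2,\zeta(X_3,X_4,X_5))\\ &\quad=\phi(\rho(\eta_1,\eta_2,X_3),X_4,X_5)+\phi(X_3,\rho(\eta_1,\eta_2,X_4),X_5)+\phi(X_3,X_4,\rho(\eta_1,\eta_2,X_5)),\\ &\theta(\eta_1,\eta_2,\zeta(X_3,X_4,X_5))=\zeta(\rho(\eta_1,\eta_2,X_3),X_4,X_5)+\zeta(X_3,\rho(\eta_1,\eta_2,X_4),X_5)+\zeta(X_3,X_4,\rho(\eta_1,\eta_2,X_5)). \end{align*} (IV) \begin{align*} &\phi(X_1,X_2,\psi(\eta_3,\eta_4,\eta_5))=\psi(\sigma(\eta_3,X_1,X_2),\eta_4,\eta_5)+\psi(\eta_3,\sigma(\eta_4,X_1,X_2),\eta_5)+\psi(\eta_3,\eta_4,\sigma(\eta_5,X_1,X_2)),\\ &\zeta(X_1,X_2,\psi(\eta_3,\eta_4,\eta_5))+\sigma(\theta(\eta_3,\eta_4,\eta_5),X_1,X_2)\\ &\quad=\theta(\sigma(\eta_3,X_1,X_2),\eta_4,\eta_5)+\theta(\eta_3,\sigma(\eta_4,X_1,X_2),\eta_5)+\theta(\eta_3,\eta_4,\sigma(\eta_5,X_1,X_2)),\\ &\sigma(\eta_2,X_1,\rho(\eta_4,\eta_5,X_3))=\theta(\sigma(\eta_2,X_1,X_3),\eta_4,\eta_5)-\sigma(\eta_5,X_3,\rho(\eta_2,\eta_4,X_1))+\sigma(\eta_4,X_3,\rho(\eta_2,\eta_5,X_1)),\\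 &\psi(\sigma(\eta_2,X_1,X_3),\eta_4,\eta_5)=0,\\ &\psi(\eta_1,\eta_2,\sigma(\eta_5,X_3,X_4))=\phi(X_3,X_4,\psi(\eta_1,\eta_2,\eta_5)),\\ &\theta(\eta_1,\eta_2,\sigma(\eta_5,X_3,X_4))=\sigma(\eta_5,\rho(\eta_1,\eta_2,X_3),X_4)+\sigma(\eta_5,X_3,\rho(\eta_1,\eta_2,X_4))\\ &\qquad+\zeta(X_3,X_4,\psi(\eta_1,\eta_2,\eta_5))+\sigma(\theta(\eta_1,\eta_2,\eta_5),X_3,X_4). \end{align*} (V) \begin{align*} &\rho(\eta_2,\theta(\eta_3,\eta_4,\eta_5),X_1)=\rho(\eta_4,\eta_5,\rho(\eta_2,\eta_3,X_1))-\rho(\eta_3,\eta_5,\rho(\eta_2,\eta_4,X_1))+\rho(\eta_3,\eta_4,\rho(\eta_2,\eta_5,X_1)),\\ &\sigma(\eta_2,\psi(\eta_3,\eta_4,\eta_5),X_1)=0,\\ &\rho(\eta_1,\eta_2,\rho(\eta_4,\eta_5,X_3))=\rho(\eta_4,\eta_5,\rho(\eta_1,\eta_2,X_3))+\rho(\theta(\eta_1,\eta_2,\eta_4),\eta_5,X_3)+\rho(\eta_4,\theta(\eta_1,\eta_2,\eta_5),X_3),\\ &\sigma(\eta_5,X_3,\psi(\eta_1,\eta_2,\eta_4))-\sigma(\eta_4,X_3,\psi(\eta_1,\eta_2,\eta_5))=0. \end{align*}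
   Context: Vector spaces are over $\mathbb{R}$. A $3$-Lie algebra is a vector space $V$ with a skew-symmetric trilinear bracket $[\bullet,\bullet,\bullet]:\wedge^3V\to V$ satisfying the fundamental (Filippov/Takhtajan) identity $$[U_1,U_2,[V_1,V_2,V_3]]=[[U_1,U_2,V_1],V_2,V_3]+[V_1,[U_1,U_2,V_2],V_3]+[V_1,V_2,[U_1,U_2,V_3]]$$ for all $U_1,U_2,V_1,V_2,V_3\in V$. The $3$-Lie algebra obtained on $\mathcal{A}\times\mathcal{B}$ is called the bicocycle double cross product $3$-Lie algebra ${\mathcal{A}}_{\zeta}\bowtie_{\psi}\mathcal{B}$. *)

(* Defs.v *)
From HB Require Import structures.
From mathcomp Require Import all_boot all_order all_algebra.
From mathcomp Require Import reals.

Set Implicit Arguments.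
Unset Strict Implicit.
Unset Printing Implicit Defensive.

Import GRing.Theory.
Local Open Scope ring_scope.

Definition trilinear (R : realType) (U1 U2 U3 W : lmodType R)
    (f : U1 -> U2 -> U3 -> W) : Prop :=
  [/\ forall y z, linear (fun x => f x y z),
      forall x z, linear (fun y => f x y z)
    & forall x y, linear (fun z => f x y z)].

(* Adjacent transpositions generate S_3, so the two sign rules give
   skew-symmetry under every permutation of the arguments. *)
Definition skew3 (R : realType) (U W : lmodType R) (f : U -> U -> U -> W) :
    Prop :=
  (forall x y z, f y x z = - f x y z) /\ (forall x y z, f x z y = - f x y z).

(* Linear maps wedge^3 U -> W. *)
Definition wedge3_map (R : realType) (U W : lmodType R)
    (f : U -> U -> U -> W) : Prop :=
  trilinear f /\ skew3 f.

(* Linear maps (wedge^2 U) (x) T -> W. *)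
Definition wedge2_tensor_map (R : realType) (U T W : lmodType R)
    (f : U -> U -> T -> W) : Prop :=
  trilinear f /\ (forall u1 u2 t, f u2 u1 t = - f u1 u2 t).

(* Linear maps T (x) (wedge^2 U) -> W. *)
Definition tensor_wedge2_map (R : realType) (T U W : lmodType R)
    (f : T -> U -> U -> W) : Prop :=
  trilinear f /\ (forall t u1 u2, f t u2 u1 = - f t u1 u2).

Definition fundamental_identity (R : realType) (V : lmodType R)
    (br : V -> V -> V -> V) : Prop :=
  forall U1 U2 V1 V2 V3 : V,
    br U1 U2 (br V1 V2 V3) =
      br (br U1 U2 V1) V2 V3 + br V1 (br U1 U2 V2) V3 + br V1 V2 (br U1 U2 V3).

Definition is_3Lie_algebra (R : realType) (V : lmodType R)
    (br : V -> V -> V -> V) : Prop :=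
  wedge3_map br /\ fundamental_identity br.

Definition bicocycle_bracket (R : realType) (A B : lmodType R)
    (phi : A -> A -> A -> A) (zeta : A -> A -> A -> B)
    (psi : B -> B -> B -> A) (theta : B -> B -> B -> B)
    (rho : B -> B -> A -> A) (sigma : B -> A -> A -> B)
    (u1 u2 u3 : (A * B)%type) : (A * B)%type :=
  let: (X1, e1) := u1 in
  let: (X2, e2) := u2 in
  let: (X3, e3) := u3 in
  (phi X1 X2 X3 + psi e1 e2 e3
     + rho e2 e3 X1 - rho e1 e3 X2 + rho e1 e2 X3,
   theta e1 e2 e3 + zeta X1 X2 X3
     + sigma e3 X1 X2 - sigma e2 X1 X3 + sigma e1 X2 X3).

(* Main.v *)
Require Import Defs.
From HB Require Import structures.
From mathcomp Require Import all_boot all_order all_algebra.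
From mathcomp Require Import reals.

Set Implicit Arguments.
Unset Strict Implicit.
Unset Printing Implicit Defensive.

Import GRing.Theory.
Local Open Scope ring_scope.

(** Call a vector of [A * B] pure if it lies in [A] or in [B].  The two sides of
    the fundamental identity for a bracket on [A * B] differ by a defect that is
    linear in its five arguments, skew in the first two and skew in the last
    three.  Multilinearity makes the identity equivalent to its restriction to
    pure arguments, and skew-symmetry allows the [A]-arguments to be moved to
    the front of each of the two groups.  There remain 3 * 4 = 12 types of
    arguments ([fundamental_identity_pure]).

    On each of these types most terms of the bicocycle bracket have a zero
    argument, and the vanishing of the defect becomes one equation in [A] and
    one in [B] (the lemmas [defect_AA_AAA] to [defect_BB_BBB]).  The resulting
    24 equations are, up to sign and order of summands, exactly the 24
    identities (I)-(V).

    That the bicocycle bracket itself is trilinear and skew is unconditional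
    ([bicocycle_wedge3]), because its terms in [rho] and those in [sigma] are
    signed sums over the cyclic choices of a distinguished argument, as in
    [wedge3_alternate].  The same construction shows that the defect is skew in
    its last three arguments ([defect_wedge3]). *)

(** * Closure properties of multilinear maps *)

Section Multilinear.
Variable R : realType.
Implicit Types U V W T : lmodType R.

Lemma linear_addE U W (f : U -> W) :
  linear f -> forall x y, f (x + y) = f x + f y.
Proof. by move=> fl x y; have := fl 1 x y; rewrite !scale1r. Qed.

Lemma linear_zeroE U W (f : U -> W) : linear f -> f 0 = 0.
Proof.
by move=> fl; apply: (addrI (f 0)); rewrite -(linear_addE fl) !addr0.
Qed.

Lemma linear_oppE U W (f : U -> W) : linear f -> forall x, f (- x) = - f x.
Proof.
move=> fl x; apply: (addrI (f x)).
by rewrite -(linear_addE fl) !subrr (linear_zeroE fl).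
Qed.

Lemma linear_compose U V W (f : V -> W) (g : U -> V) :
  linear f -> linear g -> linear (fun x => f (g x)).
Proof. by move=> fl gl a x y; rewrite gl fl. Qed.

Lemma linear_plus U W (f g : U -> W) :
  linear f -> linear g -> linear (fun x => f x + g x).
Proof. by move=> fl gl a x y; rewrite fl gl scalerDr addrACA. Qed.

Lemma linear_minus U W (f g : U -> W) :
  linear f -> linear g -> linear (fun x => f x - g x).
Proof. by move=> fl gl a x y; rewrite fl gl scalerBr opprD addrACA. Qed.

Lemma linear_pairing U V W (f : U -> V) (g : U -> W) :
  linear f -> linear g -> linear (fun x => (f x, g x)).
Proof. by move=> fl gl a x y; rewrite fl gl. Qed.

Lemma linear_fst V W : linear (fun u : V * W => u.1).
Proof. by []. Qed.

Lemma linear_snd V W : linear (fun u : V * W => u.2).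
Proof. by []. Qed.

Lemma linear_idmap U : linear (fun u : U => u).
Proof. by []. Qed.

Lemma trilinear_zeroE U1 U2 U3 W (f : U1 -> U2 -> U3 -> W) : trilinear f ->
  ((forall y z, f 0 y z = 0) * (forall x z, f x 0 z = 0))
  * (forall x y, f x y 0 = 0).
Proof.
by case=> f1 f2 f3; split; [split|] => x y;
  [apply: (linear_zeroE (f1 x y))|apply: (linear_zeroE (f2 x y))
  |apply: (linear_zeroE (f3 x y))].
Qed.

Lemma trilinear_oppE U1 U2 U3 W (f : U1 -> U2 -> U3 -> W) : trilinear f ->
  ((forall x y z, f (- x) y z = - f x y z)
   * (forall x y z, f x (- y) z = - f x y z))
  * (forall x y z, f x y (- z) = - f x y z).
Proof.
by case=> f1 f2 f3; split; [split|] => x y z;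
  [apply: (linear_oppE (f1 y z))|apply: (linear_oppE (f2 x z))
  |apply: (linear_oppE (f3 x y))].
Qed.

Lemma trilinear_compose U1 U2 U3 V1 V2 V3 W (f : V1 -> V2 -> V3 -> W)
    (p1 : U1 -> V1) (p2 : U2 -> V2) (p3 : U3 -> V3) :
  trilinear f -> linear p1 -> linear p2 -> linear p3 ->
  trilinear (fun x y z => f (p1 x) (p2 y) (p3 z)).
Proof.
by case=> f1 f2 f3 l1 l2 l3; split=> x y a u v; rewrite ?l1 ?l2 ?l3 ?f1 ?f2 ?f3.
Qed.

Lemma trilinear_rot U1 U2 U3 W (f : U1 -> U2 -> U3 -> W) :
  trilinear f -> trilinear (fun x y z => f z x y).
Proof. by case=> f1 f2 f3; split=> x y; [apply: f2|apply: f3|apply: f1]. Qed.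

Lemma trilinear_swap U1 U2 U3 W (f : U1 -> U2 -> U3 -> W) :
  trilinear f -> trilinear (fun x y z => f x z y).
Proof. by case=> f1 f2 f3; split=> x y; [apply: f1|apply: f3|apply: f2]. Qed.

Lemma trilinear_plus U1 U2 U3 W (f g : U1 -> U2 -> U3 -> W) :
  trilinear f -> trilinear g -> trilinear (fun x y z => f x y z + g x y z).
Proof.
by case=> f1 f2 f3 [g1 g2 g3]; split=> x y; apply: linear_plus.
Qed.

Lemma trilinear_minus U1 U2 U3 W (f g : U1 -> U2 -> U3 -> W) :
  trilinear f -> trilinear g -> trilinear (fun x y z => f x y z - g x y z).
Proof.
by case=> f1 f2 f3 [g1 g2 g3]; split=> x y; apply: linear_minus.
Qed.

Lemma wedge3_ext U W (f g : U -> U -> U -> W) :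
  (forall x y z, f x y z = g x y z) -> wedge3_map f -> wedge3_map g.
Proof.
move=> fg [[f1 f2 f3] [s1 s2]]; split.
  by split=> x y a u v; rewrite -!fg ?f1 ?f2 ?f3.
by split=> x y z; rewrite -!fg.
Qed.

Lemma wedge3_compose U V W T (f : V -> V -> V -> W) (p : U -> V) (q : W -> T) :
  wedge3_map f -> linear p -> linear q ->
  wedge3_map (fun x y z => q (f (p x) (p y) (p z))).
Proof.
case=> [[f1 f2 f3] [s1 s2]] pl ql; split.
  by split=> x y a u v; rewrite pl ?f1 ?f2 ?f3 ql.
by split=> x y z; [rewrite s1 | rewrite s2]; rewrite (linear_oppE ql).
Qed.

Lemma wedge3_plus U W (f g : U -> U -> U -> W) :
  wedge3_map f -> wedge3_map g -> wedge3_map (fun x y z => f x y z + g x y z).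
Proof.
case=> [f3 [s1 s2]] [g3 [t1 t2]]; split; first exact: trilinear_plus.
by split=> x y z; [rewrite s1 t1 | rewrite s2 t2]; rewrite opprD.
Qed.

Lemma wedge3_minus U W (f g : U -> U -> U -> W) :
  wedge3_map f -> wedge3_map g -> wedge3_map (fun x y z => f x y z - g x y z).
Proof.
case=> [f3 [s1 s2]] [g3 [t1 t2]]; split; first exact: trilinear_minus.
by split=> x y z; [rewrite s1 t1 | rewrite s2 t2]; rewrite opprD.
Qed.

Lemma wedge3_pairing U V W (f : U -> U -> U -> V) (g : U -> U -> U -> W) :
  wedge3_map f -> wedge3_map g -> wedge3_map (fun x y z => (f x y z, g x y z)).
Proof.
case=> [[f1 f2 f3] [s1 s2]] [[g1 g2 g3] [t1 t2]]; split.
  by split=> x y; apply: linear_pairing.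
by split=> x y z; [rewrite s1 t1 | rewrite s2 t2].
Qed.

(** Antisymmetrization of a map that is already skew in two arguments.  Three
    sums are of this shape: the terms of the bicocycle bracket in [rho], its
    terms in [sigma], and the sum [[DX, Y, Z] + [X, DY, Z] + [X, Y, DZ]] that
    measures how [D] acts on a bracket, which comes from
    [g X Y Z = [X, Y, DZ]]. *)
Lemma wedge3_alternate U W (g : U -> U -> U -> W) :
  trilinear g -> (forall x y z, g y x z = - g x y z) ->
  wedge3_map (fun x y z => g y z x - g x z y + g x y z).
Proof.
move=> g3 gs; split.
  apply: (trilinear_plus _ g3); apply: trilinear_minus.
    exact: (trilinear_rot (trilinear_rot g3)).
  exact: (trilinear_swap g3).
split=> x y z; first by rewrite (gs x y) opprD opprB.
by rewrite (gs y z) !opprD opprK addrAC.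
Qed.

End Multilinear.

(** * Reduction to pure vectors *)

Section PureVectors.
Variables (R : realType) (A B W : lmodType R).
Local Notation V := (A * B)%type.
Implicit Types (X : A) (e : B) (u v w : V).

Definition inA X : V := (X, 0).
Definition inB e : V := (0, e).

Lemma linear_pure_eq0 (f : V -> W) : linear f ->
  (forall X, f (inA X) = 0) -> (forall e, f (inB e) = 0) -> forall u, f u = 0.
Proof.
move=> fl fA fB [X e].
have -> : (X, e) = inA X + inB e 
  by apply: injective_projections; rewrite /= ?addr0 ?add0r.
by rewrite (linear_addE fl) fA fB addr0.
Qed.

Lemma skew2_pure_eq0 (f : V -> V -> W) :
  (forall v, linear (fun u => f u v)) -> (forall u v, f v u = - f u v) ->
  (forall X1 X2, f (inA X1) (inA X2) = 0) ->
  (forall X e, f (inA X) (inB e) = 0) ->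
  (forall e1 e2, f (inB e1) (inB e2) = 0) -> forall u v, f u v = 0.
Proof.
move=> fl fs fAA fAB fBB.
have fvA v X : f v (inA X) = 0.
  by move: v; apply: linear_pure_eq0 => // e; rewrite fs fAB oppr0.
have fvB v e : f v (inB e) = 0 by move: v; apply: linear_pure_eq0.
move=> u v; move: u; apply: linear_pure_eq0 => // [X|e].
  by rewrite fs fvA oppr0.
by rewrite fs fvB oppr0.
Qed.

(** Only one ordering is listed for each number of arguments in [A]: the other
    orderings follow for a skew map. *)
Definition vanishes_on_pure_triples (f : V -> V -> V -> W) : Prop :=
  [/\ forall X1 X2 X3, f (inA X1) (inA X2) (inA X3) = 0,
      forall X1 X2 e3, f (inA X1) (inA X2) (inB e3) = 0,
      forall X1 e2 e3, f (inA X1) (inB e2) (inB e3) = 0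
    & forall e1 e2 e3, f (inB e1) (inB e2) (inB e3) = 0].

(** Fixing a pure first argument leaves a skew bilinear map, to which
    [skew2_pure_eq0] applies.  With the first argument in [B], the cases that
    are not listed reduce to the first argument in [A]. *)
Lemma wedge3_pure_eq0 (f : V -> V -> V -> W) :
  wedge3_map f -> vanishes_on_pure_triples f -> forall u v w, f u v w = 0.
Proof.
case=> [[f1 f2 f3] [s1 s2]] [fAAA fAAB fABB fBBB] u v w.
have fA X v' w' : f (inA X) v' w' = 0.
  by move: v' w'; apply: skew2_pure_eq0.
have fB e v' w' : f (inB e) v' w' = 0.
  by move: v' w'; apply: skew2_pure_eq0 => // [X1 X2|X e']; rewrite s1 fA oppr0.
by move: u; apply: linear_pure_eq0.
Qed.
End PureVectors.

(** * The defect of the fundamental identity *)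

Section FilippovDefect.
Variables (R : realType) (V : lmodType R).

Definition filippov_defect (br : V -> V -> V -> V) (U1 U2 V1 V2 V3 : V) : V :=
  br U1 U2 (br V1 V2 V3) -
  (br (br U1 U2 V1) V2 V3 + br V1 (br U1 U2 V2) V3 + br V1 V2 (br U1 U2 V3)).

Variable br : V -> V -> V -> V.
Hypothesis br_wedge : wedge3_map br.

Lemma fundamental_identityP :
  fundamental_identity br <->
  forall U1 U2 V1 V2 V3, filippov_defect br U1 U2 V1 V2 V3 = 0.
Proof.
split=> FI U1 U2 V1 V2 V3; first by rewrite /filippov_defect FI subrr.
exact/subr0_eq/FI.
Qed.

(** With [D = [U1, U2, -]], the defect is [D [x, y, z]] minus the sum obtained
    by applying [D] to one argument at a time; the latter is the alternation of
    [[x, y, D z]]. *)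
Lemma defect_wedge3 U1 U2 : wedge3_map (filippov_defect br U1 U2).
Proof.
have [[br1 br2 br3] [br12 br23]] := br_wedge.
have D_lin : linear (br U1 U2) by apply: br3.
apply: wedge3_minus; first exact: (wedge3_compose br_wedge (@linear_idmap R V)).
pose g x y z := br x y (br U1 U2 z).
apply: (wedge3_ext (f := fun x y z => g y z x - g x z y + g x y z)).
  move=> x y z; rewrite /g (br23 x (br U1 U2 y)) opprK.
  by rewrite (br23 y (br U1 U2 x)) (br12 (br U1 U2 x)) opprK.
apply: wedge3_alternate => [|x y z]; last exact: br12.
by apply: (trilinear_compose br_wedge.1) => //; apply: linear_idmap.
Qed.

Lemma defect_linear1 U2 V1 V2 V3 :
  linear (fun U1 => filippov_defect br U1 U2 V1 V2 V3).
Proof.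
have [[br1 br2 br3] _] := br_wedge.
have l v : linear (fun u => br u U2 v) by apply: br1.
apply: linear_minus => //; apply: linear_plus; first apply: linear_plus.
- exact: (linear_compose (br1 _ _)).
- exact: (linear_compose (br2 _ _)).
- exact: (linear_compose (br3 _ _)).
Qed.

Lemma defect_skew U1 U2 V1 V2 V3 :
  filippov_defect br U2 U1 V1 V2 V3 = - filippov_defect br U1 U2 V1 V2 V3.
Proof.
have [/trilinear_oppE brN [br12 _]] := br_wedge.
by rewrite /filippov_defect !(br12 U1 U2) !brN -!opprD.
Qed.

End FilippovDefect.

Lemma fundamental_identity_pure (R : realType) (A B : lmodType R)
    (br : A * B -> A * B -> A * B -> A * B) :
  wedge3_map br ->
  (forall X1 X2, vanishes_on_pure_triples
     (filippov_defect br (inA B X1) (inA B X2))) ->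
  (forall X1 e2, vanishes_on_pure_triples
     (filippov_defect br (inA B X1) (inB A e2))) ->
  (forall e1 e2, vanishes_on_pure_triples
     (filippov_defect br (inB A e1) (inB A e2))) ->
  fundamental_identity br.
Proof.
move=> br_wedge vAA vAB vBB; apply/fundamental_identityP => U1 U2 V1 V2 V3.
have defect0 W1 W2 : vanishes_on_pure_triples (filippov_defect br W1 W2) ->
    filippov_defect br W1 W2 V1 V2 V3 = 0.
  move=> van.
  exact: wedge3_pure_eq0 (defect_wedge3 br_wedge W1 W2) van _ _ _.
move: U1 U2; apply: skew2_pure_eq0 => [U2|U1 U2|X1 X2|X1 e2|e1 e2].
- exact: defect_linear1.
- exact: defect_skew.
- exact/defect0/vAA.
- exact/defect0/vAB.
- exact/defect0/vBB.
Qed.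

(** * The bicocycle bracket on pure vectors *)

Lemma pair_defectP (V W : zmodType) (a1 a2 a3 a4 : V) (b1 b2 b3 b4 : W) :
  (a1, b1) - ((a2, b2) + (a3, b3) + (a4, b4)) = 0 <->
  a1 = a2 + a3 + a4 /\ b1 = b2 + b3 + b4.
Proof. by split=> [/subr0_eq[-> ->] // | [-> ->]]; exact: subrr. Qed.

Lemma opp_sum3P (V : zmodType) (a b c d : V) :
  - a = - b + c - d <-> a = b - c + d.
Proof.
have -> : - b + c - d = - (b - c + d) by rewrite !opprD opprK.
by split=> [/oppr_inj|->].
Qed.

Lemma eq0_symP (V : zmodType) (a : V) : 0 = a <-> a = 0.
Proof. by split=> /esym. Qed.

Lemma oppr_eq0P (V : zmodType) (a : V) : - a = 0 <-> a = 0.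
Proof. by split=> [/eqP|->]; rewrite ?oppr0 // oppr_eq0 => /eqP. Qed.

Section BicocycleBracket.
(* All hypotheses are kept in every lemma, so that the lemmas share one
   argument list. *)
Set Default Proof Using "All".
Variables (R : realType) (A B : lmodType R).
Variables (phi : A -> A -> A -> A) (zeta : A -> A -> A -> B).
Variables (psi : B -> B -> B -> A) (theta : B -> B -> B -> B).
Variables (rho : B -> B -> A -> A) (sigma : B -> A -> A -> B).
Hypotheses (hphi : wedge3_map phi) (hzeta : wedge3_map zeta).
Hypotheses (hpsi : wedge3_map psi) (htheta : wedge3_map theta).
Hypotheses (hrho : wedge2_tensor_map rho) (hsigma : tensor_wedge2_map sigma).

Local Notation br := (bicocycle_bracket phi zeta psi theta rho sigma).
Local Notation inA := (@inA R A B).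
Local Notation inB := (@inB R A B).
Local Notation defect := (filippov_defect br).

(** The terms in [phi], [psi], [zeta], [theta] are pulled back along the
    projections, and those in [rho] and [sigma] are alternations of maps that
    are skew in their first two arguments. *)
Lemma bicocycle_wedge3 : wedge3_map br.
Proof.
have fl := @linear_fst R A B; have sl := @linear_snd R A B.
have rl := @linear_idmap R A; have rl' := @linear_idmap R B.
pose g (u v w : A * B) := rho u.2 v.2 w.1.
pose h (u v w : A * B) := sigma w.2 u.1 v.1.
have gw : wedge3_map (fun u v w => g v w u - g u w v + g u v w).
  apply: wedge3_alternate => [|x y z]; last exact: hrho.2.
  exact: (trilinear_compose hrho.1).
have hw : wedge3_map (fun u v w => h v w u - h u w v + h u v w).
  apply: wedge3_alternate => [|x y z]; last exact: hsigma.2.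
  exact: (trilinear_rot (trilinear_compose hsigma.1 sl fl fl)).
have phiw := wedge3_compose hphi fl rl.
have zetaw := wedge3_compose hzeta fl rl'.
have psiw := wedge3_compose hpsi sl rl.
have thetaw := wedge3_compose htheta sl rl'.
apply: wedge3_ext (wedge3_pairing (wedge3_plus (wedge3_plus phiw psiw) gw)
                                  (wedge3_plus (wedge3_plus thetaw zetaw) hw)).
move=> [X1 e1] [X2 e2] [X3 e3]; rewrite /g /h /=; congr (_, _).
  by rewrite !addrA.
by rewrite (addrC (sigma e1 X2 X3 - _)) !addrA addrAC.
Qed.

Let zeroE := ((trilinear_zeroE hphi.1, trilinear_zeroE hzeta.1),
  (trilinear_zeroE hpsi.1, trilinear_zeroE htheta.1),
  (trilinear_zeroE hrho.1, trilinear_zeroE hsigma.1)).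
Let oppE := ((trilinear_oppE hphi.1, trilinear_oppE hzeta.1),
  (trilinear_oppE hpsi.1, trilinear_oppE htheta.1),
  (trilinear_oppE hrho.1, trilinear_oppE hsigma.1)).

Ltac zero_simp :=
  rewrite ?(zeroE, oppE, addr0, add0r, subr0, sub0r, oppr0, opprK).
(** Leaves an equivalence between the surviving terms of the defect,
    one equation in each of [A] and [B], and the claimed pair of identities. *)
Ltac defect_simp :=
  rewrite /filippov_defect /bicocycle_bracket /inA /inB; zero_simp;
  apply: (iff_trans (pair_defectP _ _ _ _ _ _ _ _)); zero_simp; rewrite ?addrA.

(** In the names below the first two letters give the types of [U1] and [U2],
    and the last three the types of [V1], [V2] and [V3].  When exactly one of
    [U1] and [U2] lies in [B], the bracket with them acts by [- sigma] on
    [A], which is why those cases may need a change of sign. *)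
Lemma defect_AA_AAA X1 X2 X3 X4 X5 :
  defect (inA X1) (inA X2) (inA X3) (inA X4) (inA X5) = 0 <->
  phi X1 X2 (phi X3 X4 X5) =
    phi (phi X1 X2 X3) X4 X5 + phi X3 (phi X1 X2 X4) X5
    + phi X3 X4 (phi X1 X2 X5) /\
  zeta X1 X2 (phi X3 X4 X5) + sigma (zeta X3 X4 X5) X1 X2 =
    zeta (phi X1 X2 X3) X4 X5 + sigma (zeta X1 X2 X3) X4 X5
    + zeta X3 (phi X1 X2 X4) X5 - sigma (zeta X1 X2 X4) X3 X5
    + zeta X3 X4 (phi X1 X2 X5) + sigma (zeta X1 X2 X5) X3 X4.
Proof. by defect_simp. Qed.

Lemma defect_AA_AAB X1 X2 X3 X4 e5 :
  defect (inA X1) (inA X2) (inA X3) (inA X4) (inB e5) = 0 <->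
  rho (zeta X1 X2 X3) e5 X4 - rho (zeta X1 X2 X4) e5 X3 = 0 /\
  sigma (sigma e5 X3 X4) X1 X2 =
    sigma e5 (phi X1 X2 X3) X4 + sigma e5 X3 (phi X1 X2 X4)
    + sigma (sigma e5 X1 X2) X3 X4.
Proof. defect_simp.
by rewrite eq0_symP (addrC (- rho _ _ _)) -opprB oppr_eq0P. Qed.

Lemma defect_AB_AAA X1 e2 X3 X4 X5 :
  defect (inA X1) (inB e2) (inA X3) (inA X4) (inA X5) = 0 <->
  rho e2 (zeta X3 X4 X5) X1 = 0 /\
  sigma e2 X1 (phi X3 X4 X5) =
    sigma (sigma e2 X1 X3) X4 X5 - sigma (sigma e2 X1 X4) X3 X5
    + sigma (sigma e2 X1 X5) X3 X4.
Proof. by defect_simp; rewrite opp_sum3P. Qed.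

Lemma defect_AA_ABB X1 X2 X3 e4 e5 :
  defect (inA X1) (inA X2) (inA X3) (inB e4) (inB e5) = 0 <->
  phi X1 X2 (rho e4 e5 X3) =
    psi (zeta X1 X2 X3) e4 e5 + rho e4 e5 (phi X1 X2 X3)
    + rho (sigma e4 X1 X2) e5 X3 + rho e4 (sigma e5 X1 X2) X3 /\
  zeta X1 X2 (rho e4 e5 X3) = theta (zeta X1 X2 X3) e4 e5.
Proof. by defect_simp. Qed.

Lemma defect_AB_AAB X1 e2 X3 X4 e5 :
  defect (inA X1) (inB e2) (inA X3) (inA X4) (inB e5) = 0 <->
  rho e2 (sigma e5 X3 X4) X1 =
    rho (sigma e2 X1 X3) e5 X4 - rho (sigma e2 X1 X4) e5 X3
    + phi X3 X4 (rho e2 e5 X1) /\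
  zeta X3 X4 (rho e2 e5 X1) = 0.
Proof. by defect_simp; rewrite eq0_symP. Qed.

Lemma defect_BB_AAA e1 e2 X3 X4 X5 :
  defect (inB e1) (inB e2) (inA X3) (inA X4) (inA X5) = 0 <->
  rho e1 e2 (phi X3 X4 X5) + psi e1 e2 (zeta X3 X4 X5) =
    phi (rho e1 e2 X3) X4 X5 + phi X3 (rho e1 e2 X4) X5
    + phi X3 X4 (rho e1 e2 X5) /\
  theta e1 e2 (zeta X3 X4 X5) =
    zeta (rho e1 e2 X3) X4 X5 + zeta X3 (rho e1 e2 X4) X5
    + zeta X3 X4 (rho e1 e2 X5).
Proof. by defect_simp; rewrite (addrC (psi _ _ _)). Qed.

Lemma defect_AA_BBB X1 X2 e3 e4 e5 :
  defect (inA X1) (inA X2) (inB e3) (inB e4) (inB e5) = 0 <->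
  phi X1 X2 (psi e3 e4 e5) =
    psi (sigma e3 X1 X2) e4 e5 + psi e3 (sigma e4 X1 X2) e5
    + psi e3 e4 (sigma e5 X1 X2) /\
  zeta X1 X2 (psi e3 e4 e5) + sigma (theta e3 e4 e5) X1 X2 =
    theta (sigma e3 X1 X2) e4 e5 + theta e3 (sigma e4 X1 X2) e5
    + theta e3 e4 (sigma e5 X1 X2).
Proof. by defect_simp. Qed.

Lemma defect_AB_ABB X1 e2 X3 e4 e5 :
  defect (inA X1) (inB e2) (inA X3) (inB e4) (inB e5) = 0 <->
  psi (sigma e2 X1 X3) e4 e5 = 0 /\
  sigma e2 X1 (rho e4 e5 X3) =
    theta (sigma e2 X1 X3) e4 e5 - sigma e5 X3 (rho e2 e4 X1)
    + sigma e4 X3 (rho e2 e5 X1).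
Proof. by defect_simp; rewrite opp_sum3P eq0_symP oppr_eq0P. Qed.

Lemma defect_BB_AAB e1 e2 X3 X4 e5 :
  defect (inB e1) (inB e2) (inA X3) (inA X4) (inB e5) = 0 <->
  psi e1 e2 (sigma e5 X3 X4) = phi X3 X4 (psi e1 e2 e5) /\
  theta e1 e2 (sigma e5 X3 X4) =
    sigma e5 (rho e1 e2 X3) X4 + sigma e5 X3 (rho e1 e2 X4)
    + zeta X3 X4 (psi e1 e2 e5) + sigma (theta e1 e2 e5) X3 X4.
Proof. by defect_simp. Qed.

Lemma defect_AB_BBB X1 e2 e3 e4 e5 :
  defect (inA X1) (inB e2) (inB e3) (inB e4) (inB e5) = 0 <->
  rho e2 (theta e3 e4 e5) X1 =
    rho e4 e5 (rho e2 e3 X1) - rho e3 e5 (rho e2 e4 X1)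
    + rho e3 e4 (rho e2 e5 X1) /\
  sigma e2 (psi e3 e4 e5) X1 = 0.
Proof. by defect_simp; rewrite -hsigma.2. Qed.

Lemma defect_BB_ABB e1 e2 X3 e4 e5 :
  defect (inB e1) (inB e2) (inA X3) (inB e4) (inB e5) = 0 <->
  rho e1 e2 (rho e4 e5 X3) =
    rho e4 e5 (rho e1 e2 X3) + rho (theta e1 e2 e4) e5 X3
    + rho e4 (theta e1 e2 e5) X3 /\
  sigma e5 X3 (psi e1 e2 e4) - sigma e4 X3 (psi e1 e2 e5) = 0.
Proof. by defect_simp; rewrite eq0_symP. Qed.

Lemma defect_BB_BBB e1 e2 e3 e4 e5 :
  defect (inB e1) (inB e2) (inB e3) (inB e4) (inB e5) = 0 <->
  psi e1 e2 (theta e3 e4 e5) + rho e1 e2 (psi e3 e4 e5) =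
    psi (theta e1 e2 e3) e4 e5 + rho e4 e5 (psi e1 e2 e3)
    + psi e3 (theta e1 e2 e4) e5 - rho e3 e5 (psi e1 e2 e4)
    + psi e3 e4 (theta e1 e2 e5) + rho e3 e4 (psi e1 e2 e5) /\
  theta e1 e2 (theta e3 e4 e5) =
    theta (theta e1 e2 e3) e4 e5 + theta e3 (theta e1 e2 e4) e5
    + theta e3 e4 (theta e1 e2 e5).
Proof. by defect_simp. Qed.

End BicocycleBracket.

Theorem proposition6p1 (R : realType) (A B : lmodType R)
    (phi : A -> A -> A -> A) (zeta : A -> A -> A -> B)
    (psi : B -> B -> B -> A) (theta : B -> B -> B -> B)
    (rho : B -> B -> A -> A) (sigma : B -> A -> A -> B)
    (hphi : wedge3_map phi) (hzeta : wedge3_map zeta)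
    (hpsi : wedge3_map psi) (htheta : wedge3_map theta)
    (hrho : wedge2_tensor_map rho) (hsigma : tensor_wedge2_map sigma) :
  is_3Lie_algebra (bicocycle_bracket phi zeta psi theta rho sigma) <->
  (forall (X1 X2 X3 X4 X5 : A) (e1 e2 e3 e4 e5 : B),
    (* (I) *)
    (phi X1 X2 (phi X3 X4 X5) =
       phi (phi X1 X2 X3) X4 X5 + phi X3 (phi X1 X2 X4) X5
       + phi X3 X4 (phi X1 X2 X5) /\
     zeta X1 X2 (phi X3 X4 X5) + sigma (zeta X3 X4 X5) X1 X2 =
       zeta (phi X1 X2 X3) X4 X5 + sigma (zeta X1 X2 X3) X4 X5
       + zeta X3 (phi X1 X2 X4) X5 - sigma (zeta X1 X2 X4) X3 X5
       + zeta X3 X4 (phi X1 X2 X5) + sigma (zeta X1 X2 X5) X3 X4 /\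
     theta e1 e2 (theta e3 e4 e5) =
       theta (theta e1 e2 e3) e4 e5 + theta e3 (theta e1 e2 e4) e5
       + theta e3 e4 (theta e1 e2 e5) /\
     psi e1 e2 (theta e3 e4 e5) + rho e1 e2 (psi e3 e4 e5) =
       psi (theta e1 e2 e3) e4 e5 + rho e4 e5 (psi e1 e2 e3)
       + psi e3 (theta e1 e2 e4) e5 - rho e3 e5 (psi e1 e2 e4)
       + psi e3 e4 (theta e1 e2 e5) + rho e3 e4 (psi e1 e2 e5)) /\
    (* (II) *)
    (sigma (sigma e5 X3 X4) X1 X2 =
       sigma e5 (phi X1 X2 X3) X4 + sigma e5 X3 (phi X1 X2 X4)
       + sigma (sigma e5 X1 X2) X3 X4 /\
     rho (zeta X1 X2 X3) e5 X4 - rho (zeta X1 X2 X4) e5 X3 = 0 /\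
     sigma e2 X1 (phi X3 X4 X5) =
       sigma (sigma e2 X1 X3) X4 X5 - sigma (sigma e2 X1 X4) X3 X5
       + sigma (sigma e2 X1 X5) X3 X4 /\
     rho e2 (zeta X3 X4 X5) X1 = 0) /\
    (* (III) *)
    (phi X1 X2 (rho e4 e5 X3) =
       psi (zeta X1 X2 X3) e4 e5 + rho e4 e5 (phi X1 X2 X3)
       + rho (sigma e4 X1 X2) e5 X3 + rho e4 (sigma e5 X1 X2) X3 /\
     zeta X1 X2 (rho e4 e5 X3) = theta (zeta X1 X2 X3) e4 e5 /\
     rho e2 (sigma e5 X3 X4) X1 =
       rho (sigma e2 X1 X3) e5 X4 - rho (sigma e2 X1 X4) e5 X3
       + phi X3 X4 (rho e2 e5 X1) /\
     zeta X3 X4 (rho e2 e5 X1) = 0 /\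
     rho e1 e2 (phi X3 X4 X5) + psi e1 e2 (zeta X3 X4 X5) =
       phi (rho e1 e2 X3) X4 X5 + phi X3 (rho e1 e2 X4) X5
       + phi X3 X4 (rho e1 e2 X5) /\
     theta e1 e2 (zeta X3 X4 X5) =
       zeta (rho e1 e2 X3) X4 X5 + zeta X3 (rho e1 e2 X4) X5
       + zeta X3 X4 (rho e1 e2 X5)) /\
    (* (IV) *)
    (phi X1 X2 (psi e3 e4 e5) =
       psi (sigma e3 X1 X2) e4 e5 + psi e3 (sigma e4 X1 X2) e5
       + psi e3 e4 (sigma e5 X1 X2) /\
     zeta X1 X2 (psi e3 e4 e5) + sigma (theta e3 e4 e5) X1 X2 =
       theta (sigma e3 X1 X2) e4 e5 + theta e3 (sigma e4 X1 X2) e5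
       + theta e3 e4 (sigma e5 X1 X2) /\
     sigma e2 X1 (rho e4 e5 X3) =
       theta (sigma e2 X1 X3) e4 e5 - sigma e5 X3 (rho e2 e4 X1)
       + sigma e4 X3 (rho e2 e5 X1) /\
     psi (sigma e2 X1 X3) e4 e5 = 0 /\
     psi e1 e2 (sigma e5 X3 X4) = phi X3 X4 (psi e1 e2 e5) /\
     theta e1 e2 (sigma e5 X3 X4) =
       sigma e5 (rho e1 e2 X3) X4 + sigma e5 X3 (rho e1 e2 X4)
       + zeta X3 X4 (psi e1 e2 e5) + sigma (theta e1 e2 e5) X3 X4) /\
    (* (V) *)
    (rho e2 (theta e3 e4 e5) X1 =
       rho e4 e5 (rho e2 e3 X1) - rho e3 e5 (rho e2 e4 X1)
       + rho e3 e4 (rho e2 e5 X1) /\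
     sigma e2 (psi e3 e4 e5) X1 = 0 /\
     rho e1 e2 (rho e4 e5 X3) =
       rho e4 e5 (rho e1 e2 X3) + rho (theta e1 e2 e4) e5 X3
       + rho e4 (theta e1 e2 e5) X3 /\
     sigma e5 X3 (psi e1 e2 e4) - sigma e4 X3 (psi e1 e2 e5) = 0)).
Proof.
have AAAAA := defect_AA_AAA hphi hzeta hpsi htheta hrho hsigma.
have AAAAB := defect_AA_AAB hphi hzeta hpsi htheta hrho hsigma.
have AAABB := defect_AA_ABB hphi hzeta hpsi htheta hrho hsigma.
have AABBB := defect_AA_BBB hphi hzeta hpsi htheta hrho hsigma.
have ABAAA := defect_AB_AAA hphi hzeta hpsi htheta hrho hsigma.
have ABAAB := defect_AB_AAB hphi hzeta hpsi htheta hrho hsigma.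
have ABABB := defect_AB_ABB hphi hzeta hpsi htheta hrho hsigma.
have ABBBB := defect_AB_BBB hphi hzeta hpsi htheta hrho hsigma.
have BBAAA := defect_BB_AAA hphi hzeta hpsi htheta hrho hsigma.
have BBAAB := defect_BB_AAB hphi hzeta hpsi htheta hrho hsigma.
have BBABB := defect_BB_ABB hphi hzeta hpsi htheta hrho hsigma.
have BBBBB := defect_BB_BBB hphi hzeta hpsi htheta hrho hsigma.
split=> [[_ /fundamental_identityP FI] X1 X2 X3 X4 X5 e1 e2 e3 e4 e5 | ids].
  have [] := (AAAAA X1 X2 X3 X4 X5).1 (FI _ _ _ _ _).
  have [] := (AAAAB X1 X2 X3 X4 e5).1 (FI _ _ _ _ _).
  have [] := (AAABB X1 X2 X3 e4 e5).1 (FI _ _ _ _ _).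
  have [] := (AABBB X1 X2 e3 e4 e5).1 (FI _ _ _ _ _).
  have [] := (ABAAA X1 e2 X3 X4 X5).1 (FI _ _ _ _ _).
  have [] := (ABAAB X1 e2 X3 X4 e5).1 (FI _ _ _ _ _).
  have [] := (ABABB X1 e2 X3 e4 e5).1 (FI _ _ _ _ _).
  have [] := (ABBBB X1 e2 e3 e4 e5).1 (FI _ _ _ _ _).
  have [] := (BBAAA e1 e2 X3 X4 X5).1 (FI _ _ _ _ _).
  have [] := (BBAAB e1 e2 X3 X4 e5).1 (FI _ _ _ _ _).
  have [] := (BBABB e1 e2 X3 e4 e5).1 (FI _ _ _ _ _).
  have [] := (BBBBB e1 e2 e3 e4 e5).1 (FI _ _ _ _ _).
  by do 24!move=> ?; do ![apply: conj].
have br_wedge := bicocycle_wedge3 hphi hzeta hpsi htheta hrho hsigma.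
split=> //; apply: fundamental_identity_pure => // [X1 X2|X1 e2|e1 e2]; split.
(* Each pair of identities mentions only five of the ten variables; the others
   are instantiated by 0. *)
- by move=> X3 X4 X5; apply/AAAAA; have := ids X1 X2 X3 X4 X5 0 0 0 0 0; tauto.
- by move=> X3 X4 e5; apply/AAAAB; have := ids X1 X2 X3 X4 0 0 0 0 0 e5; tauto.
- by move=> X3 e4 e5; apply/AAABB; have := ids X1 X2 X3 0 0 0 0 0 e4 e5; tauto.
- by move=> e3 e4 e5; apply/AABBB; have := ids X1 X2 0 0 0 0 0 e3 e4 e5; tauto.
- by move=> X3 X4 X5; apply/ABAAA; have := ids X1 0 X3 X4 X5 0 e2 0 0 0; tauto.
- by move=> X3 X4 e5; apply/ABAAB; have := ids X1 0 X3 X4 0 0 e2 0 0 e5; tauto.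
- by move=> X3 e4 e5; apply/ABABB; have := ids X1 0 X3 0 0 0 e2 0 e4 e5; tauto.
- by move=> e3 e4 e5; apply/ABBBB; have := ids X1 0 0 0 0 0 e2 e3 e4 e5; tauto.
- by move=> X3 X4 X5; apply/BBAAA; have := ids 0 0 X3 X4 X5 e1 e2 0 0 0; tauto.
- by move=> X3 X4 e5; apply/BBAAB; have := ids 0 0 X3 X4 0 e1 e2 0 0 e5; tauto.
- by move=> X3 e4 e5; apply/BBABB; have := ids 0 0 X3 0 0 e1 e2 0 e4 e5; tauto.
- by move=> e3 e4 e5; apply/BBBBB; have := ids 0 0 0 0 0 e1 e2 e3 e4 e5; tauto.
Qed.
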